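(* For the Legendre polynomials $P_n$ and associated Legendre functions $P_n^{k}$, and angles $\theta_1, \theta_2, \phi$, it holds that $$P_n\left( \cos\theta_1 \cos\theta_2 + \sin\theta_1 \sin\theta_2 \cos\phi \right) = P_n(\cos\theta_1) P_n(\cos\theta_2) + 2 \sum_{k=1}^{n} (-1)^k P_n^{-k}(\cos\theta_1) P_n^{k}(\cos\theta_2) \cos(k\phi).$$
   Context: $P_n$ is the $n$-th Legendre polynomial, defined by $\frac{1}{\sqrt{1 - 2xt + t^2}} = \sum_{n=0}^{\infty} P_n(x) t^n$. The associated Legendre functions are, for $0 \le m \le n$, $$P_n^m(x) = \frac{(-1)^m}{2^n n!} (1 - x^2)^{m/2} \frac{d^{n+m}}{dx^{n+m}} (x^2 - 1)^n,$$ and, for $1 \le m \le n$, $P_n^{-m}(x) = (-1)^m \frac{(n-m)!}{(n+m)!} P_n^m(x)$.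
   Formalization: The angles θ₁ and θ₂ are restricted to [0, π], since with (1−x²)^{m/2} ≥ 0 the identity fails when sin θ₁ sin θ₂ < 0 (e.g. n=1, θ₁=π/2, θ₂=−π/2, φ=0). *)

(* Defs.v *)
(* Stdlib reals with Coquelicot. *)
From Stdlib Require Import Reals ZArith.
From Coquelicot Require Import Coquelicot.

Open Scope R_scope.

(* Generating function, read as a power series in t near 0 with x any fixed
   real; this determines every P n x.  For |x| <= 1 it converges on |t| < 1. *)
Definition is_legendre (P : nat -> R -> R) : Prop :=
  forall x : R,
    locally 0 (fun t : R =>
      is_pseries (fun n : nat => P n x) t (1 / sqrt (1 - 2 * x * t + t ^ 2))).

(* (1 - x^2)^(m/2) is written with sqrt, since Rpower is wrong at base 0
   (Rpower 0 a = 1 for every a).  Meant for m <= n and -1 <= x <= 1. *)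
Definition assoc_legendre_nonneg (n m : nat) (x : R) : R :=
  (-1) ^ m / (2 ^ n * INR (fact n)) * sqrt (1 - x ^ 2) ^ m
  * Derive_n (fun y : R => (y ^ 2 - 1) ^ n) (n + m) x.

(* Meant for |k| <= n: below -n the subtraction in nat is truncated. *)
Definition assoc_legendre (n : nat) (k : Z) (x : R) : R :=
  let m := Z.abs_nat k in
  if (k <? 0)%Z
  then (-1) ^ m * (INR (fact (n - m)) / INR (fact (n + m)))
       * assoc_legendre_nonneg n m x
  else assoc_legendre_nonneg n m x.

(* Main.v *)
Require Import Defs.
From Stdlib Require Import Reals ZArith Lra Lia.
From Coquelicot Require Import Coquelicot.

(** Let q_x = s X^2/2 + x X - s/2, where x = cos theta and s = sin theta. Since
    2 s q_x = (x + s X)^2 - 1, Taylor expansion of (y^2 - 1)^n at x shows that the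
    coefficient of X^(n+k) in q_x^n is (-1)^k n!/(n+k)! P_n^k(x). For every
    quadratic b^2 - 4ac = 1, the central coefficient of (a X^2 + b X + c)^n is
    P_n(b), because it obeys the three-term recurrence that the generating
    function gives for P_n. A rotation acting on X by a Moebius transformation
    keeps the discriminant; applied to q_x it yields a quadratic whose middle
    coefficient is the argument of P_n in the theorem, and expanding the
    transformed q_x^n in the coefficients of q_x^n gives the addition formula. *)

Open Scope R_scope.

(** * Generating function: initial values and three-term recurrence *)

(** Convergence at the single point [eps / 2] suffices: beyond the radius the terms of a power
    series do not tend to 0. *)
Lemma legendre_CV_radius (P : nat -> R -> R) (hP : is_legendre P) (x : R) :
  Rbar_lt 0 (CV_radius (fun n => P n x)).
Proof.
destruct (hP x) as [eps Heps].
assert (Hd : ball 0 eps (eps / 2)).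
{ change (Rabs (eps / 2 - 0) < eps). assert (He := cond_pos eps).
  rewrite Rabs_pos_eq; lra. }
apply Rbar_lt_le_trans with (Rabs (eps / 2)).
{ simpl. apply Rabs_pos_lt. assert (He := cond_pos eps). lra. }
apply Rbar_not_lt_le; intros Hlt.
apply (CV_disk_outside _ _ Hlt).
apply is_lim_seq_ext with (fun n => scal (pow_n (eps / 2) n) (P n x)).
{ intros n. rewrite pow_n_pow. apply Rmult_comm. }
apply ex_series_lim_0. exists (1 / sqrt (1 - 2 * x * (eps / 2) + (eps / 2) ^ 2)).
exact (Heps _ Hd).
Qed.

Lemma locally_radicand_pos (x : R) : locally 0 (fun t => 0 < 1 - 2 * x * t + t ^ 2).
Proof.
apply (continuous_comp (fun t => 1 - 2 * x * t + t ^ 2) (fun y => y) 0) with (P := fun y => 0 < y).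
- apply (ex_derive_continuous (fun t : R => 1 - 2 * x * t + t ^ 2)). auto_derive. easy.
- apply continuous_id.
- apply (open_gt 0). lra.
Qed.

Lemma legendre_0 (P : nat -> R -> R) (hP : is_legendre P) (x : R) : P 0%nat x = 1.
Proof.
assert (H := is_pseries_unique _ _ _ (locally_singleton _ _ (hP x))).
rewrite PSeries_0 in H. rewrite H.
replace (1 - 2 * x * 0 + 0 ^ 2) with 1 by ring. rewrite sqrt_1. field.
Qed.

Lemma is_derive_legendre_gen (x t : R) : 0 < 1 - 2 * x * t + t ^ 2 ->
  is_derive (fun t => 1 / sqrt (1 - 2 * x * t + t ^ 2)) t
   ((x - t) / (1 - 2 * x * t + t ^ 2) * (1 / sqrt (1 - 2 * x * t + t ^ 2))).
Proof.
intros Ht.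
assert (Hs : 0 < sqrt (1 - 2 * x * t + t ^ 2)) by (apply sqrt_lt_R0; exact Ht).
assert (Hss : sqrt (1 - 2 * x * t + t ^ 2) * sqrt (1 - 2 * x * t + t ^ 2) = 1 - 2 * x * t + t ^ 2)
  by (apply sqrt_sqrt; lra).
auto_derive.
- replace (1 + - (2 * x * t) + t * (t * 1)) with (1 - 2 * x * t + t ^ 2) by ring.
  repeat split; lra.
- replace (1 + - (2 * x * t) + t * (t * 1)) with (1 - 2 * x * t + t ^ 2) by ring.
  set (d := 1 - 2 * x * t + t ^ 2) in *. set (s := sqrt d) in *.
  rewrite <- Hss. field. lra.
Qed.

(* Coefficients of (1 - 2 x t + t^2) f' = (x - t) f for the generating function f. *)
Lemma legendre_PS_ode (P : nat -> R -> R) (hP : is_legendre P) (x : R) :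
  let a := fun n => P n x in
  forall n,
  PS_plus (PS_derive a) (PS_plus (PS_scal (- 2 * x) (PS_incr_1 (PS_derive a)))
     (PS_incr_1 (PS_incr_1 (PS_derive a)))) n = PS_plus (PS_scal x a) (PS_scal (-1) (PS_incr_1 a)) n.
Proof.
intros a n.
assert (Hr : Rbar_lt 0 (CV_radius a)) by (apply legendre_CV_radius; exact hP).
assert (Hin : locally 0 (fun t => Rbar_lt (Rabs t) (CV_radius a))).
{ destruct (CV_radius a) as [r| |]; simpl in Hr |- *.
  - exists (mkposreal r Hr). intros y Hy. change (Rabs (y - 0) < r) in Hy.
    rewrite Rminus_0_r in Hy. exact Hy.
  - apply filter_forall. easy.
  - easy. }
assert (Hexa : forall t, Rbar_lt (Rabs t) (CV_radius a) -> ex_pseries a t)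
  by (intros; apply CV_radius_inside; assumption).
assert (Hexd : forall t, Rbar_lt (Rabs t) (CV_radius a) -> ex_pseries (PS_derive a) t)
  by (intros; apply CV_radius_inside; rewrite CV_radius_derive; assumption).
assert (Hscal : forall c (b : nat -> R) t, ex_pseries b t -> ex_pseries (PS_scal c b) t)
  by (intros; apply ex_pseries_scal; [apply Rmult_comm | assumption]).
assert (HR : forall b c, Rbar_lt 0 (CV_radius b) -> Rbar_lt 0 (CV_radius c) -> Rbar_lt 0 (CV_radius (PS_plus b c))).
{ intros b c Hb Hc. eapply Rbar_lt_le_trans; [|apply CV_radius_plus].
  apply Rbar_min_case; assumption. }
assert (HS : forall k b, Rbar_lt 0 (CV_radius b) -> Rbar_lt 0 (CV_radius (PS_scal k b))).
(* The scalar can vanish, as x may be 0; the series is then zero and its radius infinite. *)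
{ intros k b Hb. destruct (Req_dec k 0) as [->|Hk].
  - rewrite (CV_radius_ext _ (fun _ => 0)).
    + rewrite CV_radius_const_0. easy.
    + intros m. apply Rmult_0_l.
  - rewrite CV_radius_scal; assumption. }
(* Two power series of positive radius that agree near 0 have the same coefficients. *)
apply PSeries_ext_recip.
- apply HR; [|apply HR; [apply HS|]]; rewrite ?CV_radius_incr_1, CV_radius_derive; exact Hr.
- apply HR; apply HS; [|rewrite CV_radius_incr_1]; exact Hr.
(* Differentiating the series at t through its closed form requires the closed form on a
   neighbourhood of t, not only at t. *)
- assert (Hloc := locally_locally _ _ (hP x)).
  generalize (filter_and _ _ (filter_and _ _ Hloc (hP x)) (filter_and _ _ Hin (locally_radicand_pos x))).
  apply filter_imp. intros t [[Ht Ht0] [Htr Htp]].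
  assert (Hea := Hexa t Htr). assert (Hed := Hexd t Htr).
  assert (Hi1 := ex_pseries_incr_1 _ _ Hea).
  assert (Hi2 := ex_pseries_incr_1 _ _ Hed).
  assert (Hi3 := ex_pseries_incr_1 _ _ Hi2).
  assert (Hi4 := Hscal (- 2 * x) _ _ Hi2).
  rewrite (PSeries_plus _ _ _ Hed (ex_pseries_plus _ _ _ Hi4 Hi3)), (PSeries_plus _ _ _ Hi4 Hi3).
  rewrite (PSeries_plus _ _ _ (Hscal x _ _ Hea) (Hscal (-1) _ _ Hi1)).
  rewrite !PSeries_scal, !PSeries_incr_1.
  assert (HD : PSeries (PS_derive a) t = (x - t) / (1 - 2 * x * t + t ^ 2) * (1 / sqrt (1 - 2 * x * t + t ^ 2))).
  { rewrite <- (is_derive_unique _ _ _ (is_derive_PSeries a t Htr)).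
    apply is_derive_unique.
    apply is_derive_ext_loc with (fun t => 1 / sqrt (1 - 2 * x * t + t ^ 2)).
    - revert Ht. apply filter_imp. intros u Hu. symmetry. apply is_pseries_unique. exact Hu.
    - apply is_derive_legendre_gen. exact Htp. }
  assert (HA : PSeries a t = 1 / sqrt (1 - 2 * x * t + t ^ 2)) by exact (is_pseries_unique _ _ _ Ht0).
  rewrite HD, HA.
  set (s := sqrt _). assert (0 < s) by (apply sqrt_lt_R0; exact Htp).
  field. split; lra.
Qed.

Lemma legendre_1 (P : nat -> R -> R) (hP : is_legendre P) (x : R) : P 1%nat x = x.
Proof.
assert (H := legendre_PS_ode P hP x 0). simpl in H.
unfold PS_plus, PS_scal, PS_incr_1, PS_derive, plus, scal, zero in H. simpl in H.
unfold mult in H; simpl in H.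
rewrite (legendre_0 P hP) in H. lra.
Qed.

(** Coefficient of t^(n+1) in (1 - 2 x t + t^2) f' = (x - t) f. *)
Lemma legendre_recurrence (P : nat -> R -> R) (hP : is_legendre P) (x : R) (n : nat) :
  INR (n + 2) * P (n + 2)%nat x = INR (2 * n + 3) * x * P (n + 1)%nat x - INR (n + 1) * P n x.
Proof.
assert (H := legendre_PS_ode P hP x (n + 1)).
unfold PS_plus, PS_scal, PS_incr_1, PS_derive, plus, scal, zero in H.
replace (n + 1)%nat with (S n) in * by lia. replace (n + 2)%nat with (S (S n)) by lia.
unfold mult in H. simpl in H.
replace (2 * n + 3)%nat with (S (S (S (n + n)))) by lia.
rewrite !S_INR, plus_INR.
(* The double shift [PS_incr_1 (PS_incr_1 _)] at index n + 1 computes only once n is split into zero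
   and successor. *)
destruct n as [|n]; simpl in *; unfold mult in H; simpl in H.
- lra.
- destruct n; simpl in *;lra.
Qed.

(* Coefficients of products of linear polynomials; binary forms *)
From HB Require Import structures.
From mathcomp Require Import all_boot all_order all_algebra ring complex Rstruct.
Set Implicit Arguments.
Unset Strict Implicit.
Unset Printing Implicit Defensive.
Import Order.TTheory GRing.Theory Num.Theory.
Local Open Scope ring_scope.

(* Both sides are coefficients of X^p Y^m in
   (Y (a X + b) + (c X + d))^N = (X (a Y + c) + (b Y + d))^N. *)
Lemma coef_transpose (F : comNzRingType) (a b c d : F) (N m p : nat) :
  (m <= N)%N -> (p <= N)%N ->
  ((a *: 'X + b%:P) ^+ m * (c *: 'X + d%:P) ^+ (N - m))`_p *+ 'C(N, m) =
  ((a *: 'X + c%:P) ^+ p * (b *: 'X + d%:P) ^+ (N - p))`_m *+ 'C(N, p).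
Proof.
move=> mN pN.
(* The outer variable is Y and the inner one X, so [L]_m[_p] is the coefficient of X^p Y^m. *)
pose L : {poly {poly F}} := ((c *: 'X + d%:P)%:P + (a *: 'X + b%:P) *: 'X) ^+ N.
have -> : ((a *: 'X + b%:P) ^+ m * (c *: 'X + d%:P) ^+ (N - m))`_p *+ 'C(N, m) = L`_m`_p.
  rewrite /L [in RHS]exprDn !coef_sum [RHS](bigD1 (Ordinal (n:=N.+1) (m:=m) mN)) //= big1 ?addr0.
    by rewrite coefMn exprZn -rmorphXn coefCM coefZ coefXn eqxx mulr1 coefMn mulrC.
  move=> i; rewrite -val_eqE /= => im.
  by rewrite coefMn exprZn -rmorphXn coefCM coefZ coefXn eq_sym (negPf im) !mulr0 mul0rn coef0.
have -> : L = (map_poly polyC (b *: 'X + d%:P) + 'X%:P * map_poly polyC (a *: 'X + c%:P)) ^+ N.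
  rewrite /L; congr (_ ^+ _).
  rewrite !rmorphD /= !map_polyZ !map_polyX !map_polyC /= -!mul_polyC !rmorphD !rmorphM /=.
  by ring.
rewrite [in LHS]exprDn !coef_sum [LHS](bigD1 (Ordinal (n:=N.+1) (m:=p) pN)) //= big1 ?addr0.
  rewrite coefMn mulrC exprMn -!rmorphXn /= -mulrA -rmorphM /= coefCM coef_map /= coefMn.
  by rewrite coefXnM ltnn subnn coefC eqxx.
move=> i; rewrite -val_eqE /= => ip.
rewrite coefMn mulrC exprMn -!rmorphXn /= -mulrA -rmorphM /= coefCM coef_map /= coefMn.
rewrite coefXnM coefC; case: ltnP => // ip'; first by rewrite mul0rn.
by rewrite subn_eq0 leqNgt ltn_neqAle ip ip' mul0rn.
Qed.

Definition quadratic (F : comNzRingType) (a b c : F) : {poly F} := a *: 'X^2 + b *: 'X + c%:P.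

Lemma size_quadratic_exp (F : comNzRingType) (a b c : F) n : (size (quadratic a b c ^+ n) <= (2 * n).+1)%N.
Proof.
have H : (size (quadratic a b c) <= 3)%N.
  rewrite /quadratic; apply: (leq_trans (size_polyD _ _)); rewrite geq_max.
  rewrite (leq_trans (size_polyC_leq1 _)) // andbT.
  apply: (leq_trans (size_polyD _ _)); rewrite geq_max.
  by rewrite !(leq_trans (size_scale_leq _ _)) ?size_polyX ?size_polyXn.
apply: (leq_trans (size_poly_exp_leq _ _)); rewrite ltnS leq_mul2r.
by apply/orP; right; rewrite -subn1 leq_subLR.
Qed.

(* The binary form of degree d attached to p, evaluated at (L, M); meaningful when
   deg p <= d. *)
Definition homog (F : comNzRingType) (L M : {poly F}) (d : nat) (p : {poly F}) : {poly F} :=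
  \sum_(m < d.+1) p`_m *: (L ^+ m * M ^+ (d - m)).

Lemma homog_is_linear (F : comNzRingType) (L M : {poly F}) d : linear (homog L M d).
Proof.
move=> a p q; rewrite /homog scaler_sumr -big_split; apply: eq_bigr => m _ /=.
by rewrite coefD coefZ scalerDl scalerA.
Qed.

HB.instance Definition _ (F : comNzRingType) (L M : {poly F}) d :=
  GRing.isLinear.Build F {poly F} {poly F} *:%R (homog L M d) (homog_is_linear L M d).

Lemma homogXn (F : comNzRingType) (L M : {poly F}) d k : (k <= d)%N ->
  homog L M d 'X^k = L ^+ k * M ^+ (d - k).
Proof.
move=> kd; rewrite /homog (bigD1 (Ordinal (n:=d.+1) (m:=k) kd)) //= big1 ?addr0.
  by rewrite coefXn eqxx scale1r.
by move=> i; rewrite -val_eqE /= coefXn => /negPf ->; rewrite scale0r.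
Qed.

(** Homogenising is multiplicative when degrees add. In the induction, each monomial X^m of the n-th
    power, m <= 2n, is multiplied by the quadratic, and the three resulting monomials are
    homogenised in degree 2n + 2. *)
Lemma homog_quadratic_exp (F : comNzRingType) (a b c : F) (L M : {poly F}) n :
  homog L M (2 * n) (quadratic a b c ^+ n) =
  (a *: L ^+ 2 + b *: (L * M) + c *: M ^+ 2) ^+ n.
Proof.
elim: n => [|n IHn].
  by rewrite expr0 -(expr0 'X) homogXn // !expr0 mulr1.
have := size_quadratic_exp a b c n; rewrite [in RHS]exprS -IHn [in LHS]exprS.
move: (quadratic a b c ^+ n) => p sp.
have e : p = \sum_(m < (2 * n).+1) p`_m *: 'X^m.
  by rewrite -poly_def; apply/polyP => i; rewrite coef_poly; case: ltnP => // h; rewrite nth_default // (leq_trans sp).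
rewrite [in LHS]e [homog _ _ (2 * n) _]/homog !(mulr_sumr, linear_sum) /=; apply: eq_bigr => m _.
have mn : (m <= 2 * n)%N by rewrite -ltnS.
rewrite -scalerAr !linearZ /= -scalerAr; congr (_ *: _).
rewrite /quadratic !mulrDl -!scalerAl -exprD -exprS mul_polyC !linearD !linearZ /= mulnS.
rewrite !homogXn ?(leq_trans mn) ?leq_add2l ?leq_addl ?add1n ?ltnS //.
2:by rewrite (leq_trans mn) // leq_addl.
have -> : (2 + 2 * n - (2 + m) = 2 * n - m)%N by rewrite subnDl.
have -> : (2 + 2 * n - m.+1 = (2 * n - m).+1)%N by rewrite add2n subSS subSn.
have -> : (2 + 2 * n - m = (2 * n - m).+2)%N by rewrite add2n !subSn // ltnW.
rewrite -!mul_polyC; move: (2 * n - m)%N => k; rewrite addnC !exprD !exprS.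
by ring.
Qed.

(** The form a U^2 + b U V - a V^2 at (U, V) = (-1, X) is minus the quadratic itself. Its n-th power
    thus reproduces (-1)^n times that of the quadratic, while the coefficient of index n - k moves
    to index n + k with sign (-1)^(n-k). *)
Lemma quadratic_reverse (F : comNzRingType) (a b : F) n k : (k <= n)%N ->
  (-1) ^+ k * (quadratic a b (- a) ^+ n)`_(n - k) = (quadratic a b (- a) ^+ n)`_(n + k).
Proof.
move=> kn.
have := homog_quadratic_exp a b (- a) (-1)%:P 'X n.
have -> : (a *: (-1)%:P ^+ 2 + b *: ((-1)%:P * 'X) + - a *: 'X^2) = - quadratic a b (- a).
  by rewrite /quadratic -!mul_polyC !rmorphN /=; ring.
rewrite [X in _ = X -> _]exprNn => /(congr1 (fun p : {poly F} => p`_(n + k))) /=.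
have -> : (-1 : {poly F}) ^+ n = ((-1) ^+ n)%:P by rewrite polyC_exp polyCN polyC1.
rewrite coefCM /homog coef_sum.
have h : (n - k < (2 * n).+1)%N by rewrite ltnS (leq_trans (leq_subr _ _)) // leq_pmull.
rewrite (bigD1 (Ordinal h)) //= big1 ?addr0.
  rewrite -rmorphXn /= coefZ coefCM coefXn.
  have -> : (2 * n - (n - k) = n + k)%N by rewrite mul2n -addnn subnBA // addnAC addnK.
  rewrite eqxx mulr1 => /(congr1 (fun x => (-1) ^+ n * x)).
  rewrite signrMK => <-.
  rewrite mulrCA mulrC; congr (_ * _).
  by rewrite -[in (-1) ^+ n](subnK kn) exprD mulrAC -expr2 sqrr_sign mul1r.
move=> i; rewrite -val_eqE /= => im.
rewrite -rmorphXn /= coefZ coefCM coefXn.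
case: eqP => e; last by rewrite !mulr0.
case/negP: im; have im := ltn_ord i; rewrite ltnS in im.
by rewrite -(subKn im) -e mul2n -addnn subnDl.
Qed.

(** * Central coefficients of powers of a quadratic *)

Lemma coef_quadratic_expS (F : comNzRingType) (a b c : F) m j :
  (quadratic a b c ^+ m.+1)`_j.+1 =
  a * (if j is i.+1 then (quadratic a b c ^+ m)`_i else 0) + b * (quadratic a b c ^+ m)`_j
  + c * (quadratic a b c ^+ m)`_j.+1.
Proof.
rewrite exprS {1}/quadratic !mulrDl !coefD -!scalerAl !coefZ coefCM coefXM coefXnM /=.
by case: j => //= j; rewrite subn2.
Qed.

(** Coefficient j of (q^(m+1))' = (m+1) q' q^m, where q' = 2 a X + b. *)
Lemma coef_deriv_quadratic_expS (F : comNzRingType) (a b c : F) m j :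
  (quadratic a b c ^+ m.+1)`_j.+1 *+ j.+1 =
  (a * (if j is i.+1 then (quadratic a b c ^+ m)`_i else 0) *+ 2 + b * (quadratic a b c ^+ m)`_j) *+ m.+1.
Proof.
rewrite -coef_deriv deriv_exp coefMn; congr (_ *+ _) => /=.
have -> : (quadratic a b c)^`() = (a *+ 2) *: 'X + b%:P.
  rewrite /quadratic !derivE -!mul_polyC polyCMn expr1; ring.
rewrite mulrDl coefD -scalerAl coefZ coefCM coefXM mulrnAl.
by case: j.
Qed.

(** At j = m the factor m + 1 cancels in the derivative identity. Comparison with the product
    expansion then gives a [X^(m-1)] q^m = c [X^(m+1)] q^m, which eliminates the term in a. *)
Lemma quadratic_central_step (F : numFieldType) (a b c : F) m :
  (quadratic a b c ^+ m.+1)`_m.+1 = 2 * (c * (quadratic a b c ^+ m)`_m.+1) + b * (quadratic a b c ^+ m)`_m.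
Proof.
have H1 := coef_quadratic_expS a b c m m.
have := coef_deriv_quadratic_expS a b c m m; rewrite -[LHS]mulr_natr -[RHS]mulr_natr.
move/(mulIf _); rewrite pnatr_eq0 => /(_ isT) H2.
move: H1 H2; move: (a * _) => x -> /eqP; rewrite mulr2n -subr_eq0 => /eqP e.
apply/eqP; rewrite -subr_eq0; apply/eqP; rewrite -[RHS](oppr0) -[in RHS]e; ring.
Qed.

(** The central step at n + 1 leaves [X^(n+2)] q^(n+1), which the derivative identity reduces to the
    coefficients z, w of q^n at n and n + 1. The step at n replaces 2 c w by y - b z, with y the
    central coefficient of q^(n+1), and the discriminant condition turns 4 a c z + 2 b c w into b y
    - z. *)
Lemma quadratic_central_recurrence (F : numFieldType) (a b c : F) n :
  4 * (a * c) = b ^+ 2 - 1 ->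
  (quadratic a b c ^+ n.+2)`_n.+2 *+ n.+2 =
  b * (quadratic a b c ^+ n.+1)`_n.+1 *+ (n.+1 + n.+2)  - (quadratic a b c ^+ n)`_n *+ n.+1.
Proof.
move=> disc.
rewrite quadratic_central_step.
have H := coef_deriv_quadratic_expS a b c n n.+1.
have H0 := quadratic_central_step a b c n.
rewrite -[LHS]mulr_natr -[RHS]mulr_natr /= in H.
rewrite -[LHS]mulr_natr -[_ *+ (_ + _)]mulr_natr -[_ *+ n.+1]mulr_natr.
set x := _`_n.+2 in H *.
set y := _`_n.+1 in H0 *; set z := (polyseq (_ ^+ n))`_n in H0 H *.
set w := (polyseq (_ ^+ n))`_n.+1 in H0 H *.
rewrite natrD.
have -> : (2 * (c * x) + b * y) * n.+2%:R = 2 * (c * (x * n.+2%:R)) + b * y * n.+2%:R by ring.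
rewrite H H0.
have -> : 2 * (c * ((a * z *+ 2 + b * w) * n.+1%:R)) = (4 * (a * c) * z + 2 * b * c * w) * n.+1%:R by ring.
rewrite disc; ring.
Qed.

(** * Rotation of the quadratic and addition formula for coefficients *)

(* The Moebius substitution X -> (w / v) (c X + s) / (c - s X); with c, s the cosine
   and sine of theta_2 / 2 and w, v = e^(i phi / 2), e^(- i phi / 2) it is a rotation. *)
Lemma quadratic_rotation (F : comNzRingType) (al x c s w v : F) n :
  \sum_(m < (2 * n).+1) (quadratic al x (- al) ^+ n)`_m * (w ^+ m * v ^+ (2 * n - m)) *
     ((c *: 'X + s%:P) ^+ m * (- s *: 'X + c%:P) ^+ (2 * n - m))`_n =
  (quadratic (al * (w * c) ^+ 2 - x * (w * v) * (c * s) - al * (v * s) ^+ 2)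
      (x * (w * v) * (c ^+ 2 - s ^+ 2) + 2 * al * (c * s) * (w ^+ 2 + v ^+ 2))
      (al * (w * s) ^+ 2 + x * (w * v) * (c * s) - al * (v * c) ^+ 2) ^+ n)`_n.
Proof.
have := homog_quadratic_exp al x (- al) (w *: (c *: 'X + s%:P)) (v *: (- s *: 'X + c%:P)) n.
have -> : forall p q : {poly F}, al *: (w *: p) ^+ 2 + x *: (w *: p * (v *: q)) + (- al) *: (v *: q) ^+ 2
  = (al * w ^+ 2) *: p ^+ 2 + (x * (w * v)) *: (p * q) - (al * v ^+ 2) *: q ^+ 2.
  by move=> p q; rewrite -!mul_polyC !(rmorphM, rmorphXn, rmorphN) /=; ring.
set Q := (X in _ = X ^+ n -> _); set Q' := quadratic (_ - _) _ _.
have -> : Q = Q'.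
  rewrite /Q /Q' /quadratic -!mul_polyC !(rmorphD, rmorphM, rmorphXn, rmorphN, rmorphB, rmorph_nat) /=; ring.
move=> <-; rewrite /homog coef_sum; apply: eq_bigr => m _.
by rewrite !exprZn -scalerAl -scalerAr !coefZ !mulrA.
Qed.

(** A linear substitution multiplies the discriminant by the square of its determinant, here w v
    (c^2 + s^2) = 1. *)
Lemma quadratic_rotation_disc (F : comNzRingType) (al x c s w v : F) :
  w * v = 1 -> c ^+ 2 + s ^+ 2 = 1 -> x ^+ 2 + 4 * al ^+ 2 = 1 ->
  4 * ((al * (w * c) ^+ 2 - x * (w * v) * (c * s) - al * (v * s) ^+ 2) *
      (al * (w * s) ^+ 2 + x * (w * v) * (c * s) - al * (v * c) ^+ 2)) =
  (x * (w * v) * (c ^+ 2 - s ^+ 2) + 2 * al * (c * s) * (w ^+ 2 + v ^+ 2)) ^+ 2 - 1.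
Proof.
move=> wv cs xal.
(* Writing the constant 1 as this product makes the claim a polynomial identity. *)
have e : ((w * v) ^+ 2 * (x ^+ 2 + 4 * al ^+ 2)) * (c ^+ 2 + s ^+ 2) ^+ 2 = 1.
  by rewrite wv cs xal !expr1n !mulr1.
by rewrite -[X in _ = _ - X]e; ring.
Qed.

Lemma sum_symmetric (V : zmodType) (G : nat -> V) n :
  \sum_(m < (2 * n).+1) G m = G n + \sum_(1 <= k < n.+1) (G (n + k)%N + G (n - k)%N).
Proof.
rewrite -(big_mkord xpredT G) (@big_cat_nat _ _ _ n) //=; last by rewrite leqW // leq_pmull.
rewrite [X in _ + X]big_ltn ?ltnS ?leq_pmull // addrCA; congr (_ + _).
rewrite big_split /= addrC; congr (_ + _).
  rewrite -[n.+1 in LHS]addn1 addnC big_addn.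
  have -> : ((2 * n).+1 - n = n.+1)%N by rewrite mul2n -addnn -addnS addKn.
  by apply: eq_bigr => i _; rewrite addnC.
rewrite big_nat_rev /= add0n big_add1 /=; exact: eq_bigr.
Qed.

(** By [coef_transpose], the n-th coefficient of (c X + s)^m (- s X + c)^(2n-m) is the m-th
    coefficient of ((c X - s) (s X + c))^n, which is [B], times the binomial ratio C(2n,n) / C(2n,m)
    = m! (2n-m)! / n!^2. The terms n + k and n - k are then paired: [quadratic_reverse] applied to
    both [A] and [B] gives signs that cancel, and w v = 1 leaves w^(2k) + v^(2k). *)
Lemma quadratic_addition (F : numFieldType) (al x c s w v : F) n :
  w * v = 1 ->
  let A := quadratic al x (- al) ^+ n in
  let B := quadratic (c * s) (c ^+ 2 - s ^+ 2) (- (c * s)) ^+ n in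
  (quadratic (al * (w * c) ^+ 2 - x * (w * v) * (c * s) - al * (v * s) ^+ 2)
      (x * (w * v) * (c ^+ 2 - s ^+ 2) + 2 * al * (c * s) * (w ^+ 2 + v ^+ 2))
      (al * (w * s) ^+ 2 + x * (w * v) * (c * s) - al * (v * c) ^+ 2) ^+ n)`_n =
  A`_n * B`_n + \sum_(1 <= k < n.+1)
    A`_(n + k) * B`_(n + k) * (((n + k)`! * (n - k)`!)%:R / (n`! * n`!)%:R) * (w ^+ (2 * k) + v ^+ (2 * k)).
Proof.
move=> wv A B; rewrite -quadratic_rotation.
pose r k : F := (k`! * (2 * n - k)`!)%:R / (n`! * n`!)%:R.
pose G k := A`_k * (w ^+ k * v ^+ (2 * n - k)) * (B`_k * r k).
have factR k : k`!%:R != 0 :> F by rewrite pnatr_eq0 -lt0n fact_gt0.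
have n2 : (n <= 2 * n)%N by rewrite leq_pmull.
transitivity (\sum_(m < (2 * n).+1) G m).
  apply: eq_bigr => -[m /= hm] _; congr (_ * _); rewrite ltnS in hm.
  have := coef_transpose c s (- s) c hm n2.
  have -> : (2 * n - n = n)%N by rewrite mul2n -addnn addnK.
  have -> : (c *: 'X + (- s)%:P) ^+ n * (s *: 'X + c%:P) ^+ n = B.
    rewrite -exprMn /B /quadratic -!mul_polyC !(rmorphM, rmorphXn, rmorphN, rmorphB) /=; congr (_ ^+ _); ring.
  rewrite -[LHS]mulr_natr -[RHS]mulr_natr => H.
  have C0 : 'C(2 * n, m)%:R != 0 :> F by rewrite pnatr_eq0 -lt0n bin_gt0.
  apply: (mulIf C0); rewrite {}H -mulrA; congr (_ * _).
  have e1 := bin_fact hm; have e2 := bin_fact n2; rewrite -{}e1 in e2.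
  rewrite (_ : 2 * n - n = n)%N ?mul2n -?addnn ?addnK // in e2.
  move/(congr1 (fun k => k%:R : F)): e2; rewrite /r mul2n -addnn !natrM => e2.
  have n0 : n`!%:R * n`!%:R != 0 :> F by rewrite mulf_neq0.
  by apply: (mulIf n0); rewrite e2 [RHS]mulrAC divfK // mulrC.
rewrite (sum_symmetric G); congr (_ + _).
  rewrite /G /r (_ : 2 * n - n = n)%N; last by rewrite mul2n -addnn addnK.
  by rewrite -exprMn wv expr1n divff ?mulr1 // natrM mulf_neq0.
apply: eq_big_nat => k /andP[_ kn]; rewrite ltnS in kn.
have Hw (u t : F) : u * t = 1 -> u ^+ (n + k) * t ^+ (n - k) = u ^+ (2 * k).
  move=> ut; rewrite -[X in (X + k)%N](subnK kn) -addnA addnn -mul2n exprD mulrAC -exprMn ut.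
  by rewrite expr1n mul1r.
have h1 : (2 * n - (n + k) = n - k)%N by rewrite mul2n -addnn subnDl.
have h2 : (2 * n - (n - k) = n + k)%N by rewrite mul2n -addnn subnBA // addnAC addnK.
rewrite /G /r h1 h2 Hw // [w ^+ _ * _]mulrC Hw 1?mulrC //.
rewrite -!(quadratic_reverse _ _ kn) -/A -/B [((n - k)`! * _)%N]mulnC.
rewrite mulrDr; congr (_ + _).
  ring.
have -> : forall z y : F, (-1) ^+ k * z * ((-1) ^+ k * y) = (z * y) * ((-1) ^+ k) ^+ 2 by move=> *; ring.
by rewrite sqrr_sign; ring.
Qed.

(** * Taylor expansion and the Rodrigues form of the coefficients *)

Lemma coef_comp_affine (F : comNzRingType) (p : {poly F}) (x s : F) m :
  (p \Po (x%:P + s *: 'X))`_m = s ^+ m * p^`N(m).[x].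
Proof.
(* The bound is enlarged past the degree so that index m occurs in the Taylor sum for every m. *)
have sp : (size (map_poly polyC p) <= size p + m.+1)%N.
  by rewrite (leq_trans (size_poly _ _)) // leq_addr.
rewrite /comp_poly (nderiv_taylor_wide (mulrC _ _) sp) coef_sum.
have hm : (m < size p + m.+1)%N by rewrite addnS ltnS leq_addl.
rewrite (bigD1 (Ordinal hm)) //= big1 ?addr0.
  by rewrite nderivn_map horner_map exprZn coefCM coefZ coefXn eqxx mulr1 mulrC.
move=> i; rewrite -val_eqE /= eq_sym => /negPf im.
by rewrite nderivn_map horner_map exprZn coefCM coefZ coefXn im !mulr0.
Qed.

Lemma coef_quadratic_exp_rodrigues (F : numFieldType) (x s : F) n k :
  s ^+ 2 = 1 - x ^+ 2 -> (0 < k)%N ->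
  (quadratic (s / 2) x (- (s / 2)) ^+ n)`_(n + k) =
  s ^+ k / 2 ^+ n * (('X^2 - 1) ^+ n)^`N(n + k).[x].
Proof.
(* For s = 0 the identity 2 s q = (x + s X)^2 - 1 cannot be divided by s. There q^n = x^n X^n, and
   both sides vanish because k > 0. *)
move=> sx k0; have [->|s0] := eqVneq s 0.
  rewrite expr0n gtn_eqF // !mul0r oppr0 /quadratic scale0r add0r addr0 exprZn coefZ coefXn.
  by rewrite -[X in _ == X]addn0 eqn_add2l gtn_eqF // mulr0.
have E : (2 * s) *: quadratic (s / 2) x (- (s / 2)) = ('X^2 - 1) \Po (x%:P + s *: 'X).
  rewrite comp_polyB rmorphXn /= comp_polyX rmorph1 sqrrD exprZn sx /quadratic.
  rewrite !scalerDr !scalerA -!mul_polyC -!polyCM.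
  have -> : 2 * s * (s / 2) = s ^+ 2 by rewrite expr2; field.
  have -> : 2 * s * - (s / 2) = - s ^+ 2 by rewrite expr2; field.
  rewrite sx !(rmorphN, rmorphB, rmorphM, rmorphXn, rmorph1, rmorph_nat) /=; ring.
have := congr1 (fun p : {poly F} => (p ^+ n)`_(n + k)) E.
rewrite exprZn coefZ -rmorphXn /= coef_comp_affine exprMn exprD => H.
have c0 : 2 ^+ n * s ^+ n != 0 by rewrite mulf_neq0 ?expf_neq0 // pnatr_eq0.
apply: (mulfI c0); rewrite H mulrA; congr (_ * _).
have d0 : (2 : F) ^+ n != 0 by rewrite expf_neq0 // pnatr_eq0.
by field.
Qed.

(** A three-term recurrence is determined by two initial values, since n + 2 is invertible. The
    field is general because the rotated quadratic has its outer coefficients in [R[i]], whereas the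
    original ones are real. *)
Lemma quadratic_central_unique (F : numFieldType) (a b c : F) (f : nat -> F) :
  4 * (a * c) = b ^+ 2 - 1 -> f 0%N = 1 -> f 1%N = b ->
  (forall n, f n.+2 *+ n.+2 = b * f n.+1 *+ (n.+1 + n.+2) - f n *+ n.+1) ->
  forall n, f n = (quadratic a b c ^+ n)`_n.
Proof.
move=> disc f0 f1 fr n; suff [] : f n = (quadratic a b c ^+ n)`_n /\ f n.+1 = (quadratic a b c ^+ n.+1)`_n.+1 by [].
elim: n => [|n [IH1 IH2]].
  by rewrite f0 f1 expr0 coef1 expr1 /quadratic !coefE /= mulr0 mulr1 add0r addr0.
split=> //; apply: (mulIf (x := n.+2%:R)); first by rewrite pnatr_eq0.
by rewrite !mulr_natr fr (quadratic_central_recurrence _ disc) IH1 IH2.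
Qed.

(** * Transfer between formal polynomials, real derivatives and complex numbers *)

Lemma map_quadratic (F K : comNzRingType) (f : {rmorphism F -> K}) (a b c : F) :
  map_poly f (quadratic a b c) = quadratic (f a) (f b) (f c).
Proof. by rewrite /quadratic !rmorphD /= !map_polyZ map_polyXn map_polyX map_polyC. Qed.

Lemma is_derive_horner (p : {poly R}) (x : R) :
  is_derive (fun y : R => p.[y]) x (p^`().[x]).
Proof.
elim/poly_ind: p => [|p c IH].
  rewrite derivC horner0.
  apply: (is_derive_ext (fun _ : R => 0 : R)); last exact: is_derive_const.
  by move=> t; rewrite horner0.
rewrite derivMXaddC hornerD hornerMX.
apply: (is_derive_ext (fun y => Rplus (Rmult (p.[y]) y) c)).
  by move=> t; rewrite hornerMXaddC.
evar_last.
  apply: is_derive_plus; last exact: is_derive_const.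
  apply: is_derive_mult; [exact: IH| exact: is_derive_id|exact: Rmult_comm].
rewrite /plus /mult /one /zero /=; change (p^`().[x] * x + p.[x] * 1 + 0 = p.[x] + p^`().[x] * x :> R).
ring.
Qed.

Lemma Derive_n_horner (p : {poly R}) m (x : R) :
  Derive_n (fun y : R => p.[y]) m x = p^`(m).[x].
Proof.
elim: m x => [//|m IH] x; rewrite derivnS /=.
rewrite (Derive_ext _ _ _ IH); apply: is_derive_unique; exact: is_derive_horner.
Qed.

Lemma de_moivre (t : R) k : (cos t +i* sin t)%C ^+ k = (cos (INR k * t) +i* sin (INR k * t))%C.
Proof.
elim: k => [|k IH]; first by rewrite Rmult_0_l cos_0 sin_0.
rewrite exprS IH S_INR Rmult_plus_distr_r Rmult_1_l Rplus_comm cos_plus sin_plus.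
apply/eqP; rewrite eq_complex /=; apply/andP; split; apply/eqP.
  by [].
rewrite [in RHS]Rplus_comm; congr (_ + _); exact: Rmult_comm.
Qed.

(** * Addition formula for [P] with quadratic coefficients, for all real angles *)

Lemma legendre_addition_quadratic (P : nat -> R -> R) (hP : is_legendre P) n (t1 t2 phi : R) :
  let A := quadratic (sin t1 / 2) (cos t1) (- (sin t1 / 2)) ^+ n in
  let B := quadratic (sin t2 / 2) (cos t2) (- (sin t2 / 2)) ^+ n in
  P n (cos t1 * cos t2 + sin t1 * sin t2 * cos phi) =
  P n (cos t1) * P n (cos t2) +
  2 * \sum_(1 <= k < n.+1) A`_(n + k) * B`_(n + k) * (((n + k)`! * (n - k)`!)%:R / (n`! * n`!)%:R) * cos (INR k * phi).
Proof.
move=> A B.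
have rec x m : P m.+2 x *+ m.+2 = x * P m.+1 x *+ (m.+1 + m.+2) - P m x *+ m.+1.
  have := legendre_recurrence P hP x m.
  rewrite !plusE !multE addn1 addn2 !INRE !RealsE => H.
  have -> : (m.+1 + m.+2 = 2 * m + 3)%N by rewrite mul2n -addnn !(addSn, addnS) addn0.
  by rewrite -[P _ _ *+ m.+2]mulr_natl H -mulrA !mulr_natl.
have cs t : cos t ^+ 2 + sin t ^+ 2 = 1 by rewrite addrC; exact: (sin2_cos2 t).
have central x s : x ^+ 2 + s ^+ 2 = 1 -> P n x = (quadratic (s / 2) x (- (s / 2)) ^+ n)`_n.
  move=> e; apply: (quadratic_central_unique (f := fun m => P m x) _ (legendre_0 P hP x) (legendre_1 P hP x) (rec x)).
  by rewrite -[X in _ = _ - X]e; field.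
rewrite (central _ _ (cs t1)) (central _ _ (cs t2)) -/A -/B.
(* Half angles make the quadratic [B] of [quadratic_addition] the one attached to [t2]: c^2 - s^2 =
   cos t2 and c s = sin t2 / 2. *)
pose c := cos (t2 / 2); pose s := sin (t2 / 2).
have t2E : t2 = Rmult 2 (t2 / 2).
  by change (t2 = 2 * (t2 / 2) :> R); field.
have c2 : cos t2 = c ^+ 2 - s ^+ 2 by rewrite [in LHS]t2E cos_2a.
have s2 : sin t2 / 2 = c * s.
  rewrite [in LHS]t2E sin_2a -/c -/s; change (2 * s * c / 2 = c * s :> R); by field.
have cs2 : c ^+ 2 + s ^+ 2 = 1 by exact: cs.
pose f : {rmorphism R -> R[i]} := real_complex R.
(* These are e^(i phi/2) and its conjugate, so that w^(2k) + v^(2k) = 2 cos(k phi). *)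
pose w := (cos (phi / 2) +i* sin (phi / 2))%C; pose v := (cos (phi / 2) -i* sin (phi / 2))%C.
have wv : w * v = 1.
  apply/eqP; rewrite eq_complex /=; apply/andP; split; apply/eqP.
    by rewrite mulrN opprK -!expr2 cs.
  by rewrite mulrN mulrC addNr.
have wvX k : w ^+ (2 * k) + v ^+ (2 * k) = f (2 * cos (INR k * phi)).
  have -> : v = (cos (- (phi / 2)) +i* sin (- (phi / 2)))%C by rewrite cos_neg sin_neg.
  have e : Rmult (INR (2 * k)) (phi / 2) = Rmult (INR k) phi.
    rewrite INRE natrM; change (2 * k%:R * (phi / 2) = INR k * phi :> R).
    by rewrite INRE; field.
  rewrite !de_moivre Ropp_mult_distr_r_reverse e cos_neg sin_neg.
  apply/eqP; rewrite eq_complex /=; apply/andP; split; apply/eqP; last exact: subrr.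
  by rewrite mulr_natl mulr2n.
have wv2 : w ^+ 2 + v ^+ 2 = f (2 * cos phi).
  by have := wvX 1%N; rewrite Rmult_1_l.
have disc := quadratic_rotation_disc (al := f (sin t1 / 2)) (x := f (cos t1)) (c := f c) (s := f s) wv.
set b := f (cos t1) * (w * v) * _ + _ in disc *.
(* The middle coefficient of the rotated quadratic is real and equals the argument of [P n]. *)
have be : b = f (cos t1 * cos t2 + sin t1 * sin t2 * cos phi).
  rewrite /b wv wv2 mulr1 c2.
  have -> : sin t2 = 2 * (c * s) by rewrite -s2; field.
  rewrite !(rmorphD, rmorphM, rmorphB, rmorphXn, rmorphN, rmorph_nat, fmorphV) /=; by field.
have h1 : f c ^+ 2 + f s ^+ 2 = 1 by rewrite -!rmorphXn -rmorphD cs2 rmorph1.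
have h2 : f (cos t1) ^+ 2 + 4 * f (sin t1 / 2) ^+ 2 = 1.
  rewrite -!rmorphXn -(rmorph_nat f) -rmorphM -rmorphD -(rmorph1 f); congr (f _).
  by rewrite -[RHS](cs t1); field.
have {h1 h2}disc := disc h1 h2.
have E := @quadratic_central_unique _ _ b _ (fun m => f (P m (cos t1 * cos t2 + sin t1 * sin t2 * cos phi))) disc.
have {}E := etrans (E _ _ _ n) (quadratic_addition (f (sin t1 / 2)) (f (cos t1)) (f c) (f s) n wv).
(* The identity is proved in [R[i]] and pulled back along the embedding of the reals. *)
have finj : injective f := @complexI R.
apply: finj; rewrite {}E; first last.
- by move=> m; rewrite -!rmorphMn rec be -rmorphM -rmorphMn -rmorphB.
- by rewrite legendre_1.
- by rewrite legendre_0 // rmorph1.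
have fM x y : f (x * y) = f x * f y := rmorphM f x y.
have fn k : f k%:R = k%:R := rmorph_nat f k.
rewrite -!fM -!rmorphXn -!rmorphB -!rmorphN -!map_quadratic -!rmorphXn -s2 -c2 -/A -/B.
rewrite (rmorphD f) !coef_map -!fM; congr (_ + _).
rewrite mulr_sumr rmorph_sum; apply: eq_bigr => k _.
rewrite !coef_map wvX -!fn -(fmorphV f) -!fM; congr (f _); ring.
Qed.

(** * Associated Legendre functions as coefficients; conclusion *)

Lemma sum_n_m_bigop (f : nat -> R) n :
  sum_n_m f 1 n = \sum_(1 <= k < n.+1) f k.
Proof.
elim: n => [|n IH]; first by rewrite big_geq // sum_n_m_zero //; apply/ssrnat.ltP.
rewrite big_nat_recr //= -IH; rewrite sum_n_Sm; last by apply/ssrnat.leP.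
by [].
Qed.

Lemma assoc_legendre_nonneg_quadratic n k (t : R) : (0 < k)%N -> 0 <= sin t ->
  assoc_legendre_nonneg n k (cos t) =
  (-1) ^+ k * ((n + k)`!%:R / n`!%:R) * (quadratic (sin t / 2) (cos t) (- (sin t / 2)) ^+ n)`_(n + k).
Proof.
move=> k0 st.
have cs : sin t ^+ 2 = 1 - cos t ^+ 2.
  by rewrite -[X in X - _](sin2_cos2 t) /Rsqr; change (sin t ^+ 2 = sin t * sin t + cos t * cos t - cos t ^+ 2); ring.
rewrite (coef_quadratic_exp_rodrigues _ cs k0) /assoc_legendre_nonneg.
have -> : sqrt (1 - pow (cos t) 2)%R = sin t.
  have -> : (1 - pow (cos t) 2)%R = Rmult (sin t) (sin t) by rewrite RpowE; exact: esym cs.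
  by rewrite sqrt_square //; apply/RleP.
have -> : Derive_n (fun y : R => pow (pow y 2 - 1)%R n) (n + k)%coq_nat (cos t) =
    (('X^2 - 1) ^+ n)^`N(n + k).[cos t] *+ (n + k)`!.
  rewrite -hornerMn -nderivn_def -Derive_n_horner; apply: Derive_n_ext => y.
  by rewrite !RpowE horner_exp hornerD hornerN hornerXn hornerC.
rewrite !RpowE INRE factE.
rewrite -[_ *+ (n + k)`!]mulr_natr.
have n0 : n`!%:R != 0 :> R by rewrite pnatr_eq0 -lt0n fact_gt0.
have t0 : 2 ^+ n != 0 :> R by rewrite expf_neq0 // pnatr_eq0.
set D := _.[_].
change ((-1) ^+ k / (2 ^+ n * n`!%:R) * sin t ^+ k * (D * (n + k)`!%:R) =
 (-1) ^+ k * ((n + k)`!%:R / n`!%:R) * (sin t ^+ k / 2 ^+ n * D)).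
by field; rewrite t0 n0.
Qed.

Lemma assoc_legendre_pos n k (x : R) : assoc_legendre n (Z.of_nat k) x = assoc_legendre_nonneg n k x.
Proof.
rewrite /assoc_legendre Zabs2Nat.id.
by case: Z.ltb_spec => // /Zlt_not_le []; exact: Nat2Z.is_nonneg.
Qed.

Lemma assoc_legendre_neg n k (x : R) : (0 < k)%N ->
  assoc_legendre n (- Z.of_nat k) x =
  (-1) ^+ k * ((n - k)`!%:R / (n + k)`!%:R) * assoc_legendre_nonneg n k x.
Proof.
case: k => // k _.
rewrite /assoc_legendre /= SuccNat2Pos.id_succ.
by rewrite RpowE !INRE !factE.
Qed.

(** Four factors (-1)^k cancel: the explicit one, that of the negative order, and one from each
    coefficient formula. The factorials combine as (n-k)!/(n+k)! ((n+k)!/n!)^2. *)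
Lemma assoc_legendre_mul n k (t1 t2 : R) :
  (0 < k)%N -> 0 <= sin t1 -> 0 <= sin t2 ->
  (-1) ^+ k * assoc_legendre n (- Z.of_nat k) (cos t1)
    * assoc_legendre n (Z.of_nat k) (cos t2) =
  (quadratic (sin t1 / 2) (cos t1) (- (sin t1 / 2)) ^+ n)`_(n + k)
  * (quadratic (sin t2 / 2) (cos t2) (- (sin t2 / 2)) ^+ n)`_(n + k)
  * (((n + k)`! * (n - k)`!)%:R / (n`! * n`!)%:R).
Proof.
move=> k0 s1 s2.
rewrite assoc_legendre_neg // assoc_legendre_pos !assoc_legendre_nonneg_quadratic //.
set a := _`_(n + k); set b := _`_(n + k).
have f0 m : m`!%:R != 0 :> R by rewrite pnatr_eq0 -lt0n fact_gt0.
rewrite !natrM; set e := (-1) ^+ k.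
have e2 : e ^+ 2 = 1 by exact: sqrr_sign.
(* The right side is multiplied by (e^2)^2 = 1 to match the four signs on the left. *)
rewrite -[RHS]mul1r -[X in _ = X * _](expr1n _ 2) -[X in _ = X ^+ 2 * _]e2.
by field; rewrite !f0.
Qed.

Unset Implicit Arguments.
Local Open Scope R_scope.

Theorem theorem4p1p3 (P : nat -> R -> R) (hP : is_legendre P)
    (n : nat) (theta1 theta2 phi : R)
    (htheta1 : 0 <= theta1 <= PI) (htheta2 : 0 <= theta2 <= PI) :
  P n (cos theta1 * cos theta2 + sin theta1 * sin theta2 * cos phi) =
  P n (cos theta1) * P n (cos theta2) +
  2 * sum_n_m (fun k : nat =>
        (-1) ^ k * assoc_legendre n (- Z.of_nat k) (cos theta1)
        * assoc_legendre n (Z.of_nat k) (cos theta2) * cos (INR k * phi)) 1 n.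
Proof.
rewrite (legendre_addition_quadratic hP) sum_n_m_bigop; congr (Rplus _ (Rmult _ _)).
apply: eq_big_nat => k /andP[k0 _]; congr (Rmult _ _); apply: esym.
rewrite RpowE; apply: assoc_legendre_mul => //.
  (* On [0, PI] the sine is nonnegative, as the square root in the associated functions demands. *)
  by apply/RleP; apply: sin_ge_0; case: htheta1.
by apply/RleP; apply: sin_ge_0; case: htheta2.
Qed.
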